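(* Let $\Sigma=(X,\mathcal{D},\phi)$ be a forward complete system with equilibrium point $0$. Then the following statements are equivalent: (i) $0$ is iUGAS. (ii) $0$ is iUGS. (iii) $0$ is iULS (with a certain $\alpha\in\mathcal{K}$) and $0$ is UGWA. (iv) $0$ is an iREP and $0$ is iUGATT. (v) $0$ is iULS and $0$ is iUGATT. (vi) $0$ is iUGS and $0$ is iUGATT. Moreover, in item (iv) the function $\alpha$ can be chosen to be equal to the function $\alpha$ from item (iii).
   Context: Notation: $\mathbb{R}_+=[0,\infty)$; $B_r=\{x\in X: \|x\|_X<r\}$, $\overline{B_r}$ is its closure. Comparison functions: $\mathcal{K}$ is the set of continuous strictly increasing $\gamma:\mathbb{R}_+\to\mathbb{R}_+$ with $\gamma(0)=0$; $\mathcal{K}_\infty$ is the set of unbounded $\gamma\in\mathcal{K}$; $\mathcal{KL}$ is the set of continuous $\beta:\mathbb{R}_+^2\to\mathbb{R}_+$ such that $\beta(\cdot,t)\in\mathcal{K}$ for all $t\ge0$ and $\beta(r,\cdot)$ is decreasing to $0$ for all $r>0$. A forward complete system $\Sigma=(X,\mathcal{D},\phi)$ consists of a normed linear space $(X,\|\cdot\|_X)$; a set $\mathcal{D}$ of functions $d:\mathbb{R}_+\to D$ (disturbances), where $D$ is a nonempty subset of a normed linear space; and a map $\phi:\mathbb{R}_+\times X\times\mathcal{D}\to X$ (everywhere defined), such that: - shift invariance: for all $d\in\mathcal{D}$, $\tau\ge0$, $d(\cdot+\tau)\in\mathcal{D}$; - concatenation: for all $d_1,d_2\in\mathcal{D}$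 and $t>0$ the function equal to $d_1(\tau)$ for $\tau\in[0,t]$ and to $d_2(\tau-t)$ for $\tau>t$ is in $\mathcal{D}$; - identity: $\phi(0,x,d)=x$ for all $(x,d)$; - causality: if $d(s)=\tilde d(s)$ for all $s\in[0,t]$, then $\phi(t,x,d)=\phi(t,x,\tilde d)$; - continuity: for each $(x,d)$ the map $t\mapsto\phi(t,x,d)$ is continuous; - cocycle property: $\phi(h,\phi(t,x,d),d(t+\cdot))=\phi(t+h,x,d)$ for all $t,h\ge0$, $x\in X$, $d\in\mathcal{D}$. $0\in X$ is an equilibrium point (fixed point) if $\phi(t,0,d)=0$ for all $t\ge0$, $d\in\mathcal{D}$. Stability notions for the equilibrium $0$ (in each integral notion the function $\alpha$ is existentially quantified separately; ''with $\alpha$'' means that the notion holds for that particular $\alpha$): - UGWA (uniformly globally weakly attractive): for every $\varepsilon>0$ and $r>0$ there is $\tau=\tau(\varepsilon,r)$ such that for all $\|x\|_X\le r$ and $d\in\mathcal{D}$ there is $t\le\tau$ (depending on $x,d,\varepsilon$), $t\geq 0$, with $\|\phi(t,x,d)\|_X\le\varepsilon$. - iREP (integrally robust equilibrium point): $0$ is an equilibrium point and there is $\alpha\in\mathcal{K}$ such that for every $\varepsilon>0$ and $h>0$ there is $\delta=\delta(\varepsilon,h)>0$ such that $\|x\|_X\le\delta$, $d\in\mathcal{D}$ imply $\int_0^h\alpha(\|\phi(s,x,d)\|_X)\,ds\le\varepsilon$. - iULS (integrally uniformly locally stable): there are $\alpha\in\mathcal{K}$, $\psi\in\mathcal{K}_\infty$,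 $r>0$ such that $\|x\|_X\le r$, $d\in\mathcal{D}$ imply $\int_0^\infty\alpha(\|\phi(s,x,d)\|_X)\,ds\le\psi(\|x\|_X)$. - iUGS (integrally uniformly globally stable): there are $\alpha\in\mathcal{K}$, $\psi\in\mathcal{K}_\infty$ such that the last inequality holds for all $x\in X$, $d\in\mathcal{D}$. - iUGATT (integrally uniformly globally attractive): there is $\alpha\in\mathcal{K}$ such that for all $r>0$, $\lim_{t\to\infty}\sup_{x\in\overline{B_r},\,d\in\mathcal{D}}\int_t^\infty\alpha(\|\phi(s,x,d)\|_X)\,ds=0$. - iUGAS (integrally uniformly globally asymptotically stable): there are $\alpha\in\mathcal{K}$, $\beta\in\mathcal{KL}$ such that $\int_t^\infty\alpha(\|\phi(s,x,d)\|_X)\,ds\le\beta(\|x\|_X,t)$ for all $x\in X$, $d\in\mathcal{D}$, $t\ge0$. *)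

(* Defs.v *)
From HB Require Import structures.
From mathcomp Require Import all_boot all_order all_algebra.
From mathcomp Require Import all_classical all_reals all_analysis.

Set Implicit Arguments.
Unset Strict Implicit.
Unset Printing Implicit Defensive.

Import Order.TTheory GRing.Theory Num.Theory.
Import numFieldNormedType.Exports.

Local Open Scope classical_set_scope.
Local Open Scope ring_scope.

(** Apart from disturbances, a function on [0, +oo[ is represented by a function
    on [R] of which only the values at nonnegative arguments are constrained. *)

Section ComparisonFunctions.
Context {R : realType}.

(** [gamma r >= 0] for [r >= 0] follows from the other conditions. *)
Definition classK (gamma : R -> R) : Prop :=
  [/\ {within `[0, +oo[, continuous gamma},
      forall r s, 0 <= r -> r < s -> gamma r < gamma s
    & gamma 0 = 0].

Definition classKinfty (gamma : R -> R) : Prop :=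
  classK gamma /\ forall M, exists2 r, 0 <= r & M < gamma r.

(** "Decreasing" is read in the weak sense. *)
Definition classKL (beta : R -> R -> R) : Prop :=
  [/\ {within `[0, +oo[ `*` `[0, +oo[,
        continuous (fun p : R * R => beta p.1 p.2)},
      forall t, 0 <= t -> classK (beta ^~ t)
    & forall r, 0 < r ->
        (forall s t, 0 <= s -> s <= t -> beta r t <= beta r s) /\
        beta r t @[t --> +oo] --> (0 : R)].

End ComparisonFunctions.

Section ForwardCompleteSystems.
Context {R : realType}.

Definition shift_disturbance {U : Type} (d : {nonneg R} -> U) (t : {nonneg R}) :
    {nonneg R} -> U :=
  fun s => d (s%:num + t%:num)%:nng.

(** In the second branch [t < s], so that the absolute value, which only serves
    to stay in [{nonneg R}], is [s - t]. *)
Definition concat_disturbances {U : Type} (t : {nonneg R}) (d1 d2 : {nonneg R} -> U) :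
    {nonneg R} -> U :=
  fun s => if s%:num <= t%:num then d1 s else d2 `|s%:num - t%:num|%:nng.

(** The map [flow] is only meaningful at nonnegative times and for disturbances
    in [disturbances]. *)
Record forward_complete_system (X U : normedModType R) := ForwardCompleteSystem {
  disturbance_values : set U;
  disturbances : set ({nonneg R} -> U);
  flow : R -> X -> ({nonneg R} -> U) -> X;
  disturbance_values_neq0 : disturbance_values !=set0;
  disturbances_values : forall d s, disturbances d -> disturbance_values (d s);
  disturbances_shift : forall d t,
    disturbances d -> disturbances (shift_disturbance d t);
  disturbances_concat : forall d1 d2 (t : {nonneg R}),
    disturbances d1 -> disturbances d2 -> 0 < t%:num ->
    disturbances (concat_disturbances t d1 d2);
  flow0 : forall x d, disturbances d -> flow 0 x d = x;
  flow_causal : forall (t : {nonneg R}) x d d',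
    disturbances d -> disturbances d' ->
    (forall s : {nonneg R}, s%:num <= t%:num -> d s = d' s) ->
    flow t%:num x d = flow t%:num x d';
  flow_continuous : forall x d, disturbances d ->
    {within `[0, +oo[, continuous (fun t => flow t x d)};
  flow_cocycle : forall (t h : {nonneg R}) x d, disturbances d ->
    flow h%:num (flow t%:num x d) (shift_disturbance d t)
    = flow (t%:num + h%:num) x d
}.

Context {X U : normedModType R}.
Context (S : forward_complete_system X U).

Definition equilibrium0 : Prop :=
  forall t d, 0 <= t -> disturbances S d -> flow S t 0 d = 0.

Definition flow_integral (alpha : R -> R) (I : set R) (x : X)
    (d : {nonneg R} -> U) : \bar R :=
  (\int[lebesgue_measure]_(s in I) (alpha `|flow S s x d|)%:E)%E.

Definition UGWA : Prop :=
  forall eps r : R, 0 < eps -> 0 < r ->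
  exists tau : R, forall x d, `|x| <= r -> disturbances S d ->
  exists t : R, [/\ 0 <= t, t <= tau & `|flow S t x d| <= eps].

Definition iREP_with (alpha : R -> R) : Prop :=
  equilibrium0 /\
  forall eps h : R, 0 < eps -> 0 < h ->
  exists2 delta : R, 0 < delta &
    forall x d, `|x| <= delta -> disturbances S d ->
    (flow_integral alpha `[0%R, h] x d <= eps%:E)%E.

Definition iREP : Prop := exists2 alpha, classK alpha & iREP_with alpha.

Definition iULS_with (alpha : R -> R) : Prop :=
  exists psi : R -> R, exists r : R,
    [/\ classKinfty psi, 0 < r &
        forall x d, `|x| <= r -> disturbances S d ->
        (flow_integral alpha `[0%R, +oo[ x d <= (psi `|x|)%:E)%E].

Definition iULS : Prop := exists2 alpha, classK alpha & iULS_with alpha.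

Definition iUGS : Prop :=
  exists alpha psi : R -> R,
    [/\ classK alpha, classKinfty psi &
        forall x d, disturbances S d ->
        (flow_integral alpha `[0%R, +oo[ x d <= (psi `|x|)%:E)%E].

(** The supremum is taken in [0, +oo]: adjoining [0] makes a difference only if
    there are no disturbances at all. [closed_ball] is the closure of the open
    ball. *)
Definition iUGATT_with (alpha : R -> R) : Prop :=
  forall r : R, 0 < r ->
  ereal_sup (0%E |` [set flow_integral alpha `[t, +oo[ x d
                    | x in closed_ball (0 : X) r & d in disturbances S])
    @[t --> +oo] --> 0%E.

Definition iUGATT : Prop := exists2 alpha, classK alpha & iUGATT_with alpha.

Definition iUGAS : Prop :=
  exists (alpha : R -> R) (beta : R -> R -> R),
    [/\ classK alpha, classKL beta &
        forall x d t, disturbances S d -> 0 <= t ->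
        (flow_integral alpha `[t, +oo[ x d <= (beta `|x| t)%:E)%E].

End ForwardCompleteSystems.

(* Main.v *)
Require Import Defs.
From HB Require Import structures.
From mathcomp Require Import all_boot all_order all_algebra.
From mathcomp Require Import all_classical all_reals all_analysis.
From mathcomp Require Import measurable_realfun ring lra.
Set Implicit Arguments.
Unset Strict Implicit.
Unset Printing Implicit Defensive.
Import Order.TTheory GRing.Theory Num.Theory.
Import numFieldNormedType.Exports.
Local Open Scope classical_set_scope.
Local Open Scope ring_scope.

(** The equivalence reduces to four implications. (iii) => (iv): weak
    attraction brings every trajectory starting in a given ball into the region
    of local integral stability within a uniform time, and the cocycle property
    turns the remaining tail integral into an integral starting from there.
    (ii) => UGWA: a trajectory staying above [eps] on [[0, tau]] has integral at
    least [alpha eps * tau]. iULS => iREP: [psi] is continuous at [0].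
    (iv) => (i): after minimizing the two integrands with a bounded one, the tail
    integrals [F (x, d) t] are [1]-Lipschitz in [t], tend to [0] uniformly on
    balls, and are small near [x = 0]; the function
    [beta r t = sup_(x, d) F (x, d) t * cutoff `|x| r + r * expR (- t)]
    is then of class KL, because [cutoff u] is Lipschitz away from [r = 0]
    uniformly in [u]. *)

(** * Relative continuity of compositions and translation of integrals over half-lines *)

(** Comparison functions are continuous only within [[0, +oo[], so the outer map of a composition
    must be allowed restricted continuity as well. *)
Lemma within_continuous_comp_sub {T1 T2 T3 : topologicalType} (A : set T1)
    (B : set T2) (f : T1 -> T2) (g : T2 -> T3) :
  (forall x, A x -> B (f x)) -> {within A, continuous f} ->
  {within B, continuous g} -> {within A, continuous (g \o f)}.
Proof.
move=> fAB /subspace_continuousP fA /subspace_continuousP gB.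
apply/subspace_continuousP => x Ax V /(gB _ (fAB _ Ax)) gV.
have /= := fA _ Ax _ gV; rewrite !nbhs_simpl/= /within/= => H.
near=> y => Ay; have H2 : A y -> B (f y) -> V (g (f y)) by near: y.
exact: H2 (fAB _ Ay).
Unshelve. all: by end_near.
Qed.

(** The pushforward of Lebesgue measure under translation by [t] agrees with it on half-open
    intervals, hence everywhere by uniqueness. *)
Lemma ge0_integral_itvcy_shift {R : realType} (f : R -> \bar R) (t : R) :
  measurable_fun `[t, +oo[ f -> (forall s, t <= s -> (0 <= f s)%E) ->
  (\int[lebesgue_measure]_(s in `[t, +oo[) f s
   = \int[lebesgue_measure]_(s in `[0%R, +oo[) f (t + s)%R)%E.
Proof.
move=> mf f0.
have mshift : measurable_fun setT (+%R t : R -> measurableTypeR R).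
  exact: measurable_funD.
have -> : `[0%R, +oo[%classic = (+%R t : _ -> measurableTypeR R) @^-1` `[t, +oo[.
  by apply/seteqP; split => s /=; rewrite !in_itv/= !andbT lerDl.
transitivity
  (\int[pushforward lebesgue_measure (+%R t : _ -> measurableTypeR R)]_(s in `[t, +oo[)
    f s)%E; last first.
  apply: ge0_integral_pushforward => //.
  by move=> s; rewrite inE/= in_itv/= andbT; exact: f0.
apply: eq_measure_integral => //= A mA _.
apply: lebesgue_measure_unique => //= _ [[a b]] _ <-.
rewrite /pushforward (_ : _ @^-1` _ = `]a - t, b - t]%classic); last first.
  by apply/seteqP; split => s /=; rewrite !in_itv/= ltrBlDl lerBrDl.
rewrite lebesgue_measure_itv/= lebesgue_measure_itv/= !lte_fin ltrD2r.
by case: ifP => // _; rewrite -!EFinB; congr EFin; ring.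
Qed.

(** * Integrals of a comparison function along trajectories *)

Section FlowIntegral.
Context {R : realType} {X U : normedModType R} (S : forward_complete_system X U).
Implicit Types (alpha : R -> R) (x : X) (d : {nonneg R} -> U).

Lemma classK_ge0 alpha r : classK alpha -> 0 <= r -> 0 <= alpha r.
Proof.
move=> [_ incr a0]; rewrite le_eqVlt => /predU1P[<-|r0]; first by rewrite a0.
by rewrite -a0 ltW// incr.
Qed.

Lemma classK_gt0 alpha r : classK alpha -> 0 < r -> 0 < alpha r.
Proof. by move=> [_ incr a0] r0; rewrite -a0 incr. Qed.

Lemma classK_le alpha r s : classK alpha -> 0 <= r -> r <= s -> alpha r <= alpha s.
Proof.
by move=> [_ incr _] r0; rewrite le_eqVlt => /predU1P[->//|/(incr _ _ r0)/ltW].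
Qed.

Lemma measurable_flow_norm alpha x d : classK alpha -> disturbances S d ->
  measurable_fun `[(0:R), +oo[ (fun s => (alpha `|flow S s x d|)%:E).
Proof.
move=> [ca _ _] dd; apply/measurable_EFinP.
apply: subspace_continuous_measurable_fun => //.
suff : {within `[0, +oo[, continuous (alpha \o (fun s => `|flow S s x d|))} by [].
apply: (within_continuous_comp_sub _ _ ca).
- by move=> s _ /=; rewrite in_itv/= andbT.
- apply: (@within_continuous_comp _ _ _ _ _ (@Num.norm _ X)); last exact: flow_continuous.
  by move=> y _; exact: norm_continuous.
Qed.

Lemma flow_integral_ge0 alpha (I : set R) x d : classK alpha ->
  (0 <= flow_integral S alpha I x d)%E.
Proof. by move=> Ka; apply: integral_ge0 => s _; rewrite lee_fin classK_ge0. Qed.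

Lemma flow_integral_subset alpha (I J : set R) x d :
  classK alpha -> disturbances S d -> measurable I -> measurable J ->
  I `<=` J -> J `<=` `[0, +oo[ ->
  (flow_integral S alpha I x d <= flow_integral S alpha J x d)%E.
Proof.
move=> Ka dd mI mJ IJ J0; apply: ge0_subset_integral => //.
- apply: measurable_funS J0 _ => //; exact: measurable_flow_norm.
- by move=> s _; rewrite lee_fin classK_ge0.
Qed.

Lemma le_flow_integral alpha1 alpha2 (I : set R) x d :
  classK alpha1 -> classK alpha2 -> disturbances S d -> measurable I ->
  I `<=` `[0, +oo[ -> (forall r, 0 <= r -> alpha1 r <= alpha2 r) ->
  (flow_integral S alpha1 I x d <= flow_integral S alpha2 I x d)%E.
Proof.
move=> K1 K2 dd mI I0 le12; apply: ge0_le_integral => //.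
- by move=> s _; rewrite lee_fin classK_ge0.
- apply: measurable_funS I0 _ => //; exact: measurable_flow_norm.
- apply: measurable_funS I0 _ => //; exact: measurable_flow_norm.
- by move=> s _; rewrite lee_fin le12.
Qed.

Lemma flow_integral_split alpha (s t : R) x d :
  classK alpha -> disturbances S d -> 0 <= s -> s <= t ->
  (flow_integral S alpha `[s, +oo[ x d =
   flow_integral S alpha `[s, t[ x d + flow_integral S alpha `[t, +oo[ x d)%E.
Proof.
move=> Ka dd s0 st; rewrite /flow_integral.
have E : `[s, +oo[%classic = `[s, t[%classic `|` `[t, +oo[%classic :> set R.
  by rewrite -itv_bndbnd_setU// bnd_simp.
rewrite E ge0_integral_setU//.
- rewrite -E; apply: measurable_funS (measurable_flow_norm x Ka dd) => //.
  by apply: subset_itvr; rewrite bnd_simp.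
- by move=> u _; rewrite lee_fin classK_ge0.
- rewrite disj_set2E; apply/eqP/seteqP; split => u //= -[].
  by rewrite !in_itv/= andbT => /andP[_ ut]; rewrite leNgt ut.
Qed.

(** For [alpha] bounded by [1], this is what makes tail integrals [1]-Lipschitz in their lower
    end. *)
Lemma flow_integral_le1 alpha (s t : R) x d :
  classK alpha -> disturbances S d -> 0 <= s -> s <= t ->
  (forall r, 0 <= r -> alpha r <= 1) ->
  (flow_integral S alpha `[s, t[ x d <= (t - s)%:E)%E.
Proof.
move=> Ka dd s0 st a1.
have -> : (t - s)%:E = (\int[lebesgue_measure]_(u in `[s, t[) (cst 1%E u))%E.
  rewrite integral_cst//= mul1e lebesgue_measure_itv/= lte_fin.
  case: ltP => [_|ts]; first by rewrite -EFinB.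
  by rewrite (@le_anti _ _ s t) ?st ?ts// subrr.
apply: ge0_le_integral => //.
- by move=> u _; rewrite lee_fin classK_ge0.
- apply: measurable_funS (measurable_flow_norm x Ka dd) => //.
  by apply: subset_itv; rewrite bnd_simp.
- by move=> u _; rewrite lee_fin a1.
Qed.

(** Translating time turns the tail into a full integral, and the cocycle property identifies its
    integrand with the trajectory restarted at time [t]. *)
Lemma flow_integral_shift alpha (t : {nonneg R}) x d :
  classK alpha -> disturbances S d ->
  flow_integral S alpha `[t%:num, +oo[ x d =
  flow_integral S alpha `[0, +oo[ (flow S t%:num x d) (shift_disturbance d t).
Proof.
move=> Ka dd; rewrite /flow_integral ge0_integral_itvcy_shift.
- apply: eq_integral => s; rewrite inE/= in_itv/= andbT => s0.
  by rewrite -(flow_cocycle t (NngNum s0)).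
- apply: measurable_funS (measurable_flow_norm x Ka dd) => //.
  by apply: subset_itvr; rewrite bnd_simp.
- by move=> s _; rewrite lee_fin classK_ge0.
Qed.

(** A Chebyshev-type bound: it limits how long a trajectory of small integral can initially stay
    away from [0]. *)
Lemma flow_integral_ge alpha (tau c : R) x d :
  classK alpha -> disturbances S d -> 0 <= tau -> 0 <= c ->
  (forall s, 0 <= s -> s <= tau -> c <= `|flow S s x d|) ->
  ((alpha c * tau)%:E <= flow_integral S alpha `[0%R, +oo[ x d)%E.
Proof.
move=> Ka dd tau0 c0 flowc.
have -> : (alpha c * tau)%:E =
    (\int[lebesgue_measure]_(u in `[0%R, tau]) (cst (alpha c)%:E u))%E.
  rewrite integral_cst//= lebesgue_measure_itv/= lte_fin EFinM.
  case: ltP => [_|ts]; first by rewrite sube0.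
  by rewrite (@le_anti _ _ tau 0) ?tau0 ?ts.
apply: (@le_trans _ _ (flow_integral S alpha `[0%R, tau] x d)).
  apply: ge0_le_integral => //.
  - by move=> u _; rewrite lee_fin classK_ge0.
  - apply: measurable_funS (measurable_flow_norm x Ka dd) => //.
    by apply: subset_itvl; rewrite bnd_simp.
  - move=> u /=; rewrite in_itv/= => /andP[u0 ut].
    by rewrite lee_fin classK_le// flowc.
apply: flow_integral_subset => //.
by apply: subset_itvl; rewrite bnd_simp.
Qed.

End FlowIntegral.

(** * A class KL majorant for a family of decaying functions *)

Section KLMajorant.
Context {R : realType}.

(* Equal to [1] for [0 < u <= r] and to [0] for [u >= 2 * r]; it vanishes for
   [u = 0] because [x / 0 = 0]. *)
Definition cutoff (u r : R) : R := Num.max 0 (Num.min 1 (2 * r / u - 1)).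

Lemma cutoff_ge0 u r : 0 <= cutoff u r.
Proof. by rewrite le_max lexx. Qed.

Lemma cutoff_le1 u r : cutoff u r <= 1.
Proof. by rewrite ge_max ler01 ge_min lexx. Qed.

Lemma cutoff_le u r s : 0 <= u -> r <= s -> cutoff u r <= cutoff u s.
Proof.
move=> u0 rs; have h : 2 * r / u - 1 <= 2 * s / u - 1.
  by rewrite lerB// ler_wpM2r ?invr_ge0// ler_wpM2l.
by rewrite /cutoff; apply: le_max2 => //; exact: le_min2.
Qed.

Lemma cutoff_eq0 u r : 0 <= u -> 2 * r <= u -> cutoff u r = 0.
Proof.
move=> u0 ru; apply/max_idPl; rewrite ge_min; apply/orP; right.
move: u0; rewrite le_eqVlt => /predU1P[<-|u0]; first by rewrite invr0 mulr0; lra.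
by rewrite subr_le0 ler_pdivrMr// mul1r.
Qed.

Lemma cutoff_eq1 u r : 0 < u -> u <= r -> cutoff u r = 1.
Proof.
move=> u0 ur; rewrite /cutoff (min_idPl _) ?max_r//.
by rewrite lerBrDr ler_pdivlMr//; lra.
Qed.

(** For [u = 0] both cutoffs vanish, for [0 < u < c] both equal [1], and for [c <= u] the slope
    [2 / u] is at most [2 / c]. The constant is independent of [u], so the bound survives a supremum
    over indices. *)
Lemma cutoff_lipschitz u r s c : 0 <= u -> 0 < c -> c <= r -> c <= s ->
  cutoff u r <= cutoff u s + 2 / c * `|r - s|.
Proof.
move=> u0 c0 cr cs.
have rhs0 : 0 <= 2 / c * `|r - s| by rewrite mulr_ge0// divr_ge0// ltW.
have [uc|cu] := ltP u c.
  move: u0; rewrite le_eqVlt => /predU1P[<-|u0].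
    by rewrite /cutoff !invr0 !mulr0 lerDl.
  by rewrite !cutoff_eq1 ?lerDl// (le_trans (ltW uc)).
have : 2 * r / u - 1 <= 2 * s / u - 1 + 2 / c * `|r - s|.
  rewrite -lerBlDl (_ : _ - _ = 2 / u * (r - s)); last by ring.
  apply: (@le_trans _ _ (2 / u * `|r - s|)).
    by rewrite ler_wpM2l ?ler_norm// divr_ge0.
  rewrite ler_wpM2r// ler_wpM2l// lef_pV2// posrE//.
  exact: lt_le_trans cu.
(* Clipping to [[0, 1]] preserves a one-sided bound with nonnegative excess. *)
rewrite /cutoff; move: (2 * r / u - 1) (2 * s / u - 1) => a b ab.
rewrite ge_max addr_ge0 ?le_max ?lexx//= ge_min.
have [b1|b1] := leP 1 b.
  by apply/orP; left; rewrite (@max_r _ _ 0 1)// lerDl.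
by apply/orP; right; rewrite (le_trans ab)// lerD2r le_max lexx orbT.
Qed.

(** An index [a] stands for an initial state with a disturbance, [N a] for the norm of the state,
    and [F a t] for the integral along the trajectory from time [t] on. *)
Context {A : Type} (N : A -> R) (F : A -> R -> R).
Implicit Types (a : A) (r s t u b c e B T delta : R).
Hypotheses (N_ge0 : forall a, 0 <= N a)
  (F_ge0 : forall a t, 0 <= t -> 0 <= F a t)
  (F_decr : forall a s t, 0 <= s -> s <= t -> F a t <= F a s)
  (F_lipschitz : forall a s t, 0 <= s -> s <= t -> F a s <= F a t + (t - s))
  (F_cvg : forall e r, 0 < e -> 0 < r -> exists2 T : R, 0 <= T &
    forall a, N a <= r -> F a T <= e)
  (F_small : forall e, 0 < e -> exists2 delta : R, 0 < delta &
    forall a, N a <= delta -> F a 0 <= e).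

(** A regularized supremum over [N a <= r]: indices with [r < N a < 2 * r] enter with a weight below
    [1], which makes the dependence on [r] continuous. Adjoining [0] keeps the set nonempty when [A]
    is empty. *)
Let M (r t : R) : R :=
  sup (0 |` range (fun a => F a t * cutoff (N a) r)).

(** At some time [T] the values are at most [1]; the Lipschitz bound carries this back to time [0]
    at cost [T]. *)
Let F_bounded r : 0 <= r -> exists2 B : R, 0 <= B & forall a, N a <= r -> F a 0 <= B.
Proof.
move=> r0; have [T T0 FT] := F_cvg ltr01 (ltr_wpDl r0 ltr01).
exists (1 + T); first by rewrite addr_ge0.
move=> a Nar; apply: le_trans (F_lipschitz a (lexx _) T0) _.
by rewrite subr0 lerD2r FT// (le_trans Nar)// lerDl.
Qed.

Let M_le r t c : 0 <= c ->
  (forall a, N a <= 2 * r -> F a t * cutoff (N a) r <= c) -> M r t <= c.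
Proof.
move=> c0 Fc; apply: ge_sup; first by exists 0; left.
move=> _ [->//|[a _ <-]].
have [/Fc//|/ltW ra] := leP (N a) (2 * r).
by rewrite cutoff_eq0// mulr0.
Qed.

Let M_has_sup r t : 0 <= r -> 0 <= t ->
  has_sup (0 |` range (fun a => F a t * cutoff (N a) r)).
Proof.
move=> r0 t0; split; first by exists 0; left.
have [B B0 FB] := F_bounded (mulr_ge0 (ler0n _ 2) r0).
exists B => _ [->//|[a _ <-]].
have [ar|/ltW ra] := leP (N a) (2 * r); last by rewrite cutoff_eq0// mulr0.
apply: le_trans (le_trans (F_decr a (lexx _) t0) (FB _ ar)).
by rewrite ler_piMr ?F_ge0// cutoff_le1.
Qed.

Let M_ge a r t : 0 <= r -> 0 <= t -> F a t * cutoff (N a) r <= M r t.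
Proof. by move=> r0 t0; apply: ub_le_sup; [case: (M_has_sup r0 t0)|right; exists a]. Qed.

Let M_ge0 r t : 0 <= r -> 0 <= t -> 0 <= M r t.
Proof. by move=> r0 t0; apply: ub_le_sup; [case: (M_has_sup r0 t0)|left]. Qed.

Let M_incr r s t : 0 <= r -> r <= s -> 0 <= t -> M r t <= M s t.
Proof.
move=> r0 rs t0; have s0 := le_trans r0 rs.
apply: M_le => [|a _]; first exact: M_ge0.
by apply: le_trans (M_ge a s0 t0); rewrite ler_wpM2l ?F_ge0 ?cutoff_le.
Qed.

Let M_decr r s t : 0 <= r -> 0 <= s -> s <= t -> M r t <= M r s.
Proof.
move=> r0 s0 st; apply: M_le => [|a _]; first exact: M_ge0.
by apply: le_trans (M_ge a r0 s0); rewrite ler_wpM2r ?cutoff_ge0 ?F_decr.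
Qed.

Let M_small r t e : 0 <= t -> 0 <= e ->
  (forall a, N a <= 2 * r -> F a t <= e) -> M r t <= e.
Proof.
move=> t0 e0 Fe; apply: M_le => // a /Fe; apply: le_trans.
by rewrite ler_piMr ?F_ge0// cutoff_le1.
Qed.

(** Changing the time costs [|t - u|], since [F] is [1]-Lipschitz; changing the radius costs at most
    [B] times the variation of the cutoff, which is controlled because both radii are at least
    [c]. *)
Let M_lipschitz b c B r s t u : 0 < c -> c <= r -> c <= s -> r <= b ->
  0 <= t -> 0 <= u -> 0 <= B -> (forall a, N a <= 2 * b -> F a 0 <= B) ->
  M r t <= M s u + (B * (2 / c * `|r - s|) + `|t - u|).
Proof.
move=> c0 cr cs rb t0 u0 B0 FB.
have s0 := le_trans (ltW c0) cs.
have d0 : 0 <= 2 / c * `|r - s| by rewrite mulr_ge0// divr_ge0// ltW.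
apply: M_le => [|a ar].
  by rewrite addr_ge0 ?M_ge0// addr_ge0// mulr_ge0.
have Fau : F a t <= F a u + `|t - u|.
  have [tu|/ltW ut] := leP t u.
    by rewrite distrC ger0_norm ?subr_ge0// F_lipschitz.
  by apply: le_trans (F_decr a u0 ut) _; rewrite lerDl.
have FuB : F a u <= B.
  apply: le_trans (F_decr a (lexx _) u0) (FB _ (le_trans ar _)).
  by rewrite ler_wpM2l.
apply: (@le_trans _ _ (F a u * cutoff (N a) r + `|t - u|)).
  apply: le_trans (ler_wpM2r (cutoff_ge0 _ _) Fau) _.
  by rewrite mulrDl lerD2l ler_piMr// cutoff_le1.
rewrite addrA lerD2r.
apply: (@le_trans _ _ (F a u * (cutoff (N a) s + 2 / c * `|r - s|))).
  by rewrite ler_wpM2l ?F_ge0// cutoff_lipschitz.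
by rewrite mulrDr lerD ?M_ge// ler_wpM2r.
Qed.

Let M0 t : 0 <= t -> M 0 t = 0.
Proof.
move=> t0; apply/eqP; rewrite eq_le M_ge0// andbT.
by apply: M_le => // a _; rewrite cutoff_eq0 ?mulr0.
Qed.

Let M_continuous :
  {within `[0, +oo[ `*` `[0, +oo[, continuous (fun p : R * R => M p.1 p.2)}.
Proof.
apply/subspace_continuousP => -[r t] [/=]; rewrite !in_itv/= !andbT => r0 t0.
apply/cvgrPdist_le => e e0; rewrite near_withinE /from_subspace/=.
move: r0; rewrite le_eqVlt => /predU1P[<-|r0].
  (* [M] vanishes at radius [0], so smallness of [F] near [N a = 0] suffices; [delta / 2] is taken
     because [M] at radius [p.1] sees indices up to [2 * p.1]. *)
  have [delta delta0 Fe] := F_small e0.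
  near=> p => -[/=]; rewrite !in_itv/= !andbT => p1 p2.
  have [/= bp _] : ball ((0, t) : R * R) (delta / 2) p.
    by near: p; apply: nbhsx_ballx; rewrite divr_gt0.
  rewrite M0// sub0r normrN ger0_norm ?M_ge0//.
  apply: M_small => //; first exact: ltW.
  move=> a ap; apply: le_trans (F_decr a (lexx _) p2) (Fe _ (le_trans ap _)).
  move: bp; rewrite /ball/= sub0r normrN ger0_norm//; lra.
(* Nearby radii are at most [2 * r] and see indices with [N a <= 2 * (2 * r)]. *)
have [B B0 FB] := F_bounded (mulr_ge0 (ler0n _ 2) (mulr_ge0 (ler0n _ 2) (ltW r0))).
pose K := B * (2 / (r / 2)).
have K0 : 0 <= K by rewrite mulr_ge0// divr_ge0// divr_ge0// ltW.
(* The first bound keeps [p.1] in [[r / 2, 2 * r]]; the second makes [K * eta + eta] at most [e]. *)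
pose eta := Num.min (r / 2) (e / (K + 1)).
have eta0 : 0 < eta by rewrite lt_min !divr_gt0// ltr_wpDl.
near=> p => -[/=]; rewrite !in_itv/= !andbT => p1 p2.
have [/= bp1 bp2] : ball ((r, t) : R * R) eta p.
  by near: p; exact: nbhsx_ballx.
move: bp1 bp2; rewrite /ball/= => bp1 bp2.
have /andP[rp pr] : r / 2 <= p.1 <= 2 * r.
  have : `|r - p.1| < r / 2 by rewrite (lt_le_trans bp1)// ge_min lexx.
  by rewrite ltr_norml => /andP[? ?]; lra.
have r2 : r / 2 <= r by lra.
have close : B * (2 / (r / 2) * `|r - p.1|) + `|t - p.2| <= e.
  rewrite mulrA -/K.
  apply: (@le_trans _ _ ((K + 1) * eta)).
    by rewrite mulrDl mul1r lerD ?ler_wpM2l// ltW.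
  by rewrite mulrC -ler_pdivlMr ?ltr_wpDl// ge_min lexx orbT.
rewrite ler_norml; apply/andP; split.
- rewrite lerNl opprB lerBlDl.
  apply: le_trans (M_lipschitz (b := 2 * r) (c := r / 2) (s := r) _ _ _ _ _ t0 B0 FB) _ => //.
  + by rewrite divr_gt0.
  + by rewrite lerD2l distrC (distrC p.2).
- rewrite lerBlDl.
  apply: le_trans (M_lipschitz (b := 2 * r) (c := r / 2) (s := p.1) _ _ _ _ t0 p2 B0 FB) _ => //.
  + by rewrite divr_gt0.
  + lra.
  + by rewrite lerD2l.
Unshelve. all: by end_near. Qed.

(** [M] dominates [F] because the cutoff equals [1] at [r = N a > 0]. It is only weakly increasing
    in [r]; the summand [r * expR (- t)] makes the growth strict and still tends to [0] as [t]
    grows. *)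
Lemma KL_majorant : exists2 beta, classKL beta &
  forall a t, 0 <= t -> F a t <= beta (N a) t.
Proof.
have gc : continuous (fun p : R * R => p.1 * expR (- p.2)).
  have cfst : continuous (@fst R R) by move=> p; exact: cvg_fst.
  have csnd : continuous (@snd R R) by move=> p; exact: cvg_snd.
  move=> p; apply: cvgM; first exact: cfst.
  apply: continuous_cvg; first exact: continuous_expR.
  by apply: cvgN; exact: csnd.
exists (fun r t => M r t + r * expR (- t)).
  have cbeta : {within `[0, +oo[ `*` `[0, +oo[,
      continuous (fun p : R * R => M p.1 p.2 + p.1 * expR (- p.2))}.
    apply: within_continuousD; first exact: M_continuous.
    exact: continuous_subspaceT.
  split; first exact: cbeta.
  - move=> t t0; split; last by rewrite M0// mul0r addr0.
    + apply: (within_continuous_comp_sub (f := fun r : R => (r, t)) _ _ cbeta).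
        by move=> r; rewrite /= !in_itv/= !andbT.
      by apply: continuous_subspaceT => r; exact: (cvg_pair cvg_id (cvg_cst t)).
    + move=> r s r0 rs; rewrite ler_ltD//; first by rewrite M_incr// ltW.
      by rewrite ltr_pM2r// expR_gt0.
  - move=> r r0; split.
    + move=> s t s0 st; rewrite lerD ?M_decr//; first exact: ltW.
      by rewrite ler_wpM2l ?(ltW r0)// ler_expR lerN2.
    + rewrite -[0]addr0; apply: cvgD; last first.
        rewrite -[X in _ --> X](mulr0 r); apply: cvgMr; exact: cvgr_expR.
      apply/cvgrPdist_le => e e0.
      (* Only indices with [N a <= 2 * r] matter for [M r t]. *)
      have r20 : 0 < 2 * r by rewrite mulr_gt0.
      have [T T0 FT] := F_cvg e0 r20.
      near=> t.
      have Tt : T <= t by near: t; apply: nbhs_pinfty_ge; exact: num_real.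
      rewrite sub0r normrN ger0_norm; last by apply: M_ge0; [exact: ltW|exact: le_trans Tt].
      apply: M_small; [exact: le_trans Tt|exact: ltW|].
      by move=> a /FT; apply: le_trans; exact: F_decr.
move=> a t t0; have := N_ge0 a; rewrite le_eqVlt => /predU1P[Na0|Na].
  (* For [N a = 0] the cutoff vanishes and gives no bound; instead [F_small], used for every [e],
     forces [F a t <= 0]. *)
  rewrite -Na0 M0// mul0r addr0.
  apply/ler_addgt0Pl => e e0; rewrite addr0.
  have [delta delta0 Fe] := F_small e0.
  by apply: le_trans (F_decr a (lexx _) t0) (Fe _ _); rewrite -Na0 ltW.
rewrite -[F a t]mulr1 -[X in _ * X](cutoff_eq1 Na (lexx _)).
apply: le_trans (M_ge a (N_ge0 a) t0) _.
by rewrite lerDl mulr_ge0// expR_ge0.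
Unshelve. all: by end_near. Qed.

End KLMajorant.

(** * Comparison functions of class K *)

Section ClassK.
Context {R : realType}.

Lemma classK_min (alpha1 alpha2 : R -> R) : classK alpha1 -> classK alpha2 ->
  classK (fun r => Num.min (alpha1 r) (alpha2 r)).
Proof.
move=> [c1 i1 z1] [c2 i2 z2]; split; last by rewrite z1 z2 minxx.
  by move=> r; apply: continuous_min; [exact: c1|exact: c2].
move=> r s r0 rs; rewrite lt_min !gt_min; apply/andP; split; apply/orP.
- by left; exact: i1.
- by right; exact: i2.
Qed.

(** Being bounded by [1], this function serves to truncate other comparison functions through
    minima. *)
Lemma classK_saturation : classK (fun r : R => 1 - expR (- r)).
Proof.
split; last by rewrite oppr0 expR0 subrr.
  apply: continuous_subspaceT => r; apply: cvgB; first exact: cvg_cst.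
  by apply: continuous_cvg; [exact: continuous_expR|apply: cvgN; exact: cvg_id].
by move=> r s _ rs; rewrite ler_ltB// ltr_expR ltrN2.
Qed.

Lemma classK_small (psi : R -> R) (e : R) : classK psi -> 0 < e ->
  exists2 delta, 0 < delta & psi delta <= e.
Proof.
move=> [/subspace_continuousP cpsi _ psi0] e0.
have z0 : `[0, +oo[%classic (0 : R) by rewrite /= in_itv/= lexx.
have /cvgrPdist_le/(_ _ e0) := cpsi 0 z0.
rewrite near_withinE /from_subspace/= psi0 => /nbhs_ballP[eta /= eta0 H].
exists (eta / 2); first by rewrite divr_gt0.
have : `|0 - psi (eta / 2)| <= e.
  apply: H; last by rewrite /= in_itv/= andbT divr_ge0// ltW.
  by rewrite /ball/= sub0r normrN gtr0_norm ?divr_gt0// ltr_pdivrMr// ltr_pMr// ltr1n.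
by rewrite sub0r normrN; apply: le_trans; exact: ler_norm.
Qed.

End ClassK.

(** * Implications between the stability notions *)

Section IntegralStability.
Context {R : realType} {X U : normedModType R} (S : forward_complete_system X U).
Implicit Types (alpha : R -> R) (x : X) (d : {nonneg R} -> U).

(** Tail integrals decrease in their starting time, so a bound at a single [T] persists; the closed
    ball is the set [|x| <= r]. *)
Lemma iUGATT_withP alpha : classK alpha ->
  iUGATT_with S alpha <->
  forall e r : R, 0 < e -> 0 < r -> exists2 T : R, 0 <= T &
    forall x d, `|x| <= r -> disturbances S d ->
    (flow_integral S alpha `[T, +oo[ x d <= e%:E)%E.
Proof.
pose tail r t := ereal_sup (0%E |` [set flow_integral S alpha `[t, +oo[ x d
  | x in closed_ball (0 : X) r & d in disturbances S]).
move=> Ka; split => [att e r e0 r0|att r r0].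
  have near0 : nbhs 0%E [set y : \bar R | (y < e%:E)%E].
    by apply: open_nbhs_nbhs; split; [exact: open_ereal_lt_ereal|rewrite /= lte_fin].
  have := att r r0 _ near0; rewrite /= => H.
  near (@pinfty_nbhs R) => T.
  exists T; first by near: T; apply: nbhs_pinfty_ge; exact: num_real.
  move=> x d xr dd.
  have : (tail r T < e%:E)%E by near: T.
  move=> /ltW; apply: le_trans; apply: ereal_sup_ubound; right.
  by exists x; [rewrite closed_ballE//= /closed_ball_/= sub0r normrN|exists d].
have small e : 0 < e -> \forall t \near +oo,
    (0 <= tail r t <= e%:E)%E.
  move=> e0; have [T T0 H] := att e r e0 r0.
  near=> t; apply/andP; split; first by apply: ereal_sup_ubound; left.
  have Tt : T <= t by near: t; apply: nbhs_pinfty_ge; exact: num_real.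
  apply: ge_ereal_sup => _ [->|[x + [d dd <-]]]; first by rewrite lee_fin ltW.
  rewrite closed_ballE//= /closed_ball_/= sub0r normrN => xr.
  apply: le_trans (H x d xr dd); apply: flow_integral_subset => //.
  - by apply: subset_itvr; rewrite bnd_simp.
  - by apply: subset_itvr; rewrite bnd_simp.
apply/fine_cvgP; split.
  near=> t.
  have /andP[h0 h1] : (0 <= tail r t <= 1%:E)%E.
    by near: t; exact: small.
  by rewrite ge0_fin_numE// (le_lt_trans h1)// ltry.
apply/cvgrPdist_le => e e0; near=> t => /=.
have /andP[h0 h1] : (0 <= tail r t <= e%:E)%E.
  by near: t; exact: small.
rewrite sub0r normrN ger0_norm ?fine_ge0//.
by rewrite -lee_fin fineK// ge0_fin_numE// (le_lt_trans h1)// ltry.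
Unshelve. all: by end_near. Qed.

(** At time [0] the function [beta] is of class K but may be bounded; adding [r] makes it
    unbounded. *)
Lemma iUGAS_iUGS : iUGAS S -> iUGS S.
Proof.
move=> [alpha [beta [Ka [_ Kb _] H]]].
have Kb0 := Kb 0 (lexx _); have [cb ib b0] := Kb0.
exists alpha, (fun r => beta r 0 + r); split => //.
- split; first split.
  + apply: within_continuousD => //.
    by apply: continuous_subspaceT => r; exact: cvg_id.
  + by move=> r s r0 rs; rewrite ltrD// ib.
  + by rewrite b0 addr0.
  + move=> M; have r0 : 0 <= Num.max 0 M + 1 by rewrite addr_ge0// le_max lexx.
    exists (Num.max 0 M + 1) => //.
    apply: ltr_wpDl; first exact: (classK_ge0 Kb0).
    by rewrite ltr_pwDr// le_max lexx orbT.
- move=> x d dd; apply: le_trans (H x d 0 dd (lexx _)) _.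
  by rewrite lee_fin lerDl.
Qed.

Lemma iUGS_iULS : iUGS S -> iULS S.
Proof.
move=> [alpha [psi [Ka Kpsi H]]]; exists alpha => //; exists psi, 1.
by split => // x d _; exact: H.
Qed.

Lemma iUGS_UGWA : iUGS S -> UGWA S.
Proof.
move=> [alpha [psi [Ka [Kpsi _] H]]] e r e0 r0.
have ae := classK_gt0 Ka e0.
(* Multiplied by [alpha e], this time gives [psi r + alpha e], which exceeds the available bound
   [psi r]. *)
have tau0 : 0 <= psi r / alpha e + 1.
  rewrite addr_ge0// divr_ge0 ?(ltW ae)//.
  by rewrite (classK_ge0 Kpsi)// ltW.
exists (psi r / alpha e + 1) => x d xr dd.
apply: contrapT => /forallNP no.
have : ((alpha e * (psi r / alpha e + 1))%:E <= (psi r)%:E)%E.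
  apply: le_trans (flow_integral_ge (x := x) Ka dd tau0 (ltW e0) _) _.
    move=> s s0 st; rewrite leNgt; apply/negP => se.
    by apply: (no s); split => //; exact: ltW.
  by apply: le_trans (H x d dd) _; rewrite lee_fin (classK_le Kpsi).
rewrite lee_fin mulrDr mulr1 mulrC divfK ?gt_eqF// leNgt => /negP; apply.
by rewrite ltrDl.
Qed.

Lemma iULS_iREP_with alpha : classK alpha -> equilibrium0 S ->
  iULS_with S alpha -> iREP_with S alpha.
Proof.
move=> Ka S0 [psi [r [[Kpsi _] r0 H]]]; split => // e h e0 h0.
have [delta delta0 psie] := classK_small Kpsi e0.
exists (Num.min r delta); first by rewrite lt_min r0.
move=> x d; rewrite le_min => /andP[xr xd] dd.
apply: (@le_trans _ _ (flow_integral S alpha `[0%R, +oo[ x d)).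
  by apply: flow_integral_subset => //; apply: subset_itvl; rewrite bnd_simp.
apply: le_trans (H x d xr dd) _; rewrite lee_fin.
by apply: le_trans psie; exact: classK_le.
Qed.

(** Weak attraction does not involve [alpha], so the function from local stability is kept. *)
Lemma iULS_UGWA_iUGATT_with alpha : classK alpha ->
  iULS_with S alpha -> UGWA S -> iUGATT_with S alpha.
Proof.
move=> Ka [psi [rho [[Kpsi _] rho0 H]]] wa.
apply/(iUGATT_withP Ka) => e r e0 r0.
have [delta delta0 psie] := classK_small Kpsi e0.
(* Below [rho] the reached state obeys the local stability estimate; below [delta] that estimate is
   at most [e]. *)
have min0 : 0 < Num.min rho delta by rewrite lt_min rho0.
have [tau tauP] := wa _ _ min0 r0.
(* Without disturbances, the time supplied by weak attraction may be negative. *)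
exists (Num.max 0 tau); first by rewrite le_max lexx.
move=> x d xr dd; have [t [t0 tt]] := tauP x d xr dd.
rewrite le_min => /andP[frho fdelta].
apply: (@le_trans _ _ (flow_integral S alpha `[t, +oo[ x d)).
  apply: flow_integral_subset => //.
  - by apply: subset_itvr; rewrite bnd_simp le_max tt orbT.
  - by apply: subset_itvr; rewrite bnd_simp.
rewrite (flow_integral_shift (NngNum t0) x Ka dd).
apply: le_trans (H _ _ frho (disturbances_shift _ dd)) _; rewrite lee_fin.
by apply: le_trans psie; exact: classK_le.
Qed.

(* The functions of the two hypotheses are replaced by a common minorant
   bounded by [1]: the time spent before attraction sets in then contributes
   at most its length, even though trajectories need not be bounded on bounded
   time intervals, and the tail integrals are Lipschitz in time. *)
Lemma iREP_iUGATT_iUGAS : iREP S -> iUGATT S -> iUGAS S.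
Proof.
move=> [alpha1 K1 [_ rep]] [alpha2 K2 /(iUGATT_withP K2) att].
pose alpha r := Num.min (Num.min (alpha1 r) (alpha2 r)) (1 - expR (- r)).
have Ka : classK alpha.
  by apply: classK_min; [exact: classK_min|exact: classK_saturation].
have alpha_le1 r : 0 <= r -> alpha r <= 1.
  by move=> _; rewrite ge_min; apply/orP; right; rewrite gerBl expR_ge0.
have alpha_le_alpha1 r : 0 <= r -> alpha r <= alpha1 r.
  by move=> _; rewrite !ge_min lexx.
have alpha_le_alpha2 r : 0 <= r -> alpha r <= alpha2 r.
  by move=> _; rewrite !ge_min lexx orbT.
have tail e r : 0 < e -> 0 < r -> exists2 T : R, 0 <= T &
    forall x d, `|x| <= r -> disturbances S d ->
    (flow_integral S alpha `[T, +oo[ x d <= e%:E)%E.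
  move=> e0 r0; have [T T0 H] := att e r e0 r0; exists T => // x d xr dd.
  apply: le_trans (H x d xr dd); apply: le_flow_integral => //.
  by apply: subset_itvr; rewrite bnd_simp.
(* The integral up to [T] is at most [T] since [alpha] is at most [1], and the tail beyond [T] is at
   most [1]. *)
have fin x d t : disturbances S d -> 0 <= t ->
    flow_integral S alpha `[t, +oo[ x d \is a fin_num.
  move=> dd t0; rewrite ge0_fin_numE ?flow_integral_ge0//.
  have [T T0 H] := tail 1 (`|x| + 1) ltr01 (ltr_wpDl (normr_ge0 x) ltr01).
  apply: (@le_lt_trans _ _ (flow_integral S alpha `[0, +oo[ x d)).
    apply: flow_integral_subset => //.
    by apply: subset_itvr; rewrite bnd_simp.
  rewrite (flow_integral_split x Ka dd (lexx 0) T0).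
  apply: (@le_lt_trans _ _ ((T - 0)%:E + 1%:E)%E); last by rewrite -EFinD ltry.
  by apply: leeD; [exact: flow_integral_le1|apply: H; rewrite ?lerDl].
pose A := {xd : X * ({nonneg R} -> U) | disturbances S xd.2}.
pose F (a : A) t := fine (flow_integral S alpha `[t, +oo[ (sval a).1 (sval a).2).
have [beta Kb Hb] : exists2 beta, classKL beta &
    forall (a : A) t, 0 <= t -> F a t <= beta `|(sval a).1| t.
  apply: (KL_majorant (N := fun a : A => `|(sval a).1|)).
  - by move=> a.
  - by move=> a t _; rewrite fine_ge0// flow_integral_ge0.
  - move=> [[x d] /= dd] s t s0 st; have t0 := le_trans s0 st.
    rewrite /F/= fine_le ?fin//; apply: flow_integral_subset => //.
    + by apply: subset_itvr; rewrite bnd_simp.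
    + by apply: subset_itvr; rewrite bnd_simp.
  - move=> [[x d] /= dd] s t s0 st; have t0 := le_trans s0 st.
    rewrite -lee_fin EFinD /F/= !fineK ?fin//.
    rewrite (flow_integral_split x Ka dd s0 st) addeC.
    by apply: leeD => //; exact: flow_integral_le1.
  - move=> e r e0 r0; have [T T0 H] := tail e r e0 r0; exists T => //.
    by move=> [[x d] /= dd] xr; rewrite -lee_fin fineK ?fin//; exact: H.
  (* Attraction bounds the tail beyond a time [T] uniformly on the unit ball; robustness then bounds
     the part before [T] for small states. *)
  - move=> e e0; have e20 : 0 < e / 2 by rewrite divr_gt0.
    have [T T0 H] := tail _ _ e20 ltr01.
    (* Robustness asks for a positive horizon, while [T] may be [0]. *)
    have T10 : 0 < T + 1 by rewrite ltr_wpDl.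
    have [delta delta0 Hdelta] := rep (e / 2) (T + 1) e20 T10.
    exists (Num.min 1 delta); first by rewrite lt_min ltr01.
    move=> [[x d] /= dd]; rewrite le_min => /andP[x1 xd].
    rewrite -lee_fin fineK ?fin//= (flow_integral_split x Ka dd (lexx 0) T0).
    rewrite (splitr e) EFinD; apply: leeD; last exact: H.
    apply: le_trans (Hdelta x d xd dd).
    apply: (@le_trans _ _ (flow_integral S alpha `[0, T + 1] x d)).
      apply: flow_integral_subset => //.
      * by apply: subset_itvl; rewrite bnd_simp lerDl.
      * by apply: subset_itvl; rewrite bnd_simp.
    apply: le_flow_integral => //.
    by apply: subset_itvl; rewrite bnd_simp.
exists alpha, beta; split => // x d t dd t0.
have := Hb (exist _ (x, d) dd) t t0.
by rewrite /F/= -lee_fin fineK ?fin.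
Qed.

End IntegralStability.

Theorem theorem1 (R : realType) (X U : normedModType R) (S : forward_complete_system X U)
    (S0 : equilibrium0 S) :
  [<-> iUGAS S;
       iUGS S;
       iULS S /\ UGWA S;
       iREP S /\ iUGATT S;
       iULS S /\ iUGATT S;
       iUGS S /\ iUGATT S]
  /\ (forall alpha : R -> R, classK alpha -> iULS_with S alpha -> UGWA S ->
      iREP_with S alpha /\ iUGATT_with S alpha).
Proof.
have LS_REP : iULS S -> iREP S.
  by move=> [alpha Ka ls]; exists alpha => //; exact: iULS_iREP_with.
split; last first.
  move=> alpha Ka ls wa; split; first exact: iULS_iREP_with.
  exact: iULS_UGWA_iUGATT_with.
(* The implications form a cycle; those leaving a statement that contains [iUGATT] all pass through
   [iUGAS]. *)
tfae.
- exact: iUGAS_iUGS.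
- by move=> gs; split; [exact: iUGS_iULS|exact: iUGS_UGWA].
- move=> [ls wa]; split; first exact: LS_REP.
  by have [alpha Ka lsa] := ls; exists alpha => //; exact: iULS_UGWA_iUGATT_with.
- move=> [rep att]; split=> //.
  by apply/iUGS_iULS/iUGAS_iUGS; exact: iREP_iUGATT_iUGAS.
- move=> [ls att]; split=> //.
  by apply: iUGAS_iUGS; apply: iREP_iUGATT_iUGAS => //; exact: LS_REP.
- move=> [gs att]; apply: iREP_iUGATT_iUGAS => //.
  by apply: LS_REP; exact: iUGS_iULS.
Qed.
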